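(* Let $g_2,\lambda,g_3$ be parameters and let $\tau(z)=z+\sum_{n\ge 2}C_n z^{n+1}$ be the Taylor expansion at $z=0$ of the normalized tau-function of the first Painlevé equation $u''=6u^2-6\lambda z-\tfrac{1}{2}g_2$ associated with the solution $u(z;g_2,\lambda,g_3)$, with $C_0=1$, $C_1=0$. Then the coefficients $C_n$ belong to $\mathbb{Q}[g_2,\lambda,g_3]$, and they are uniquely determined by the recursion $$ n(n^2-1)(n-6)\,C_n=-\frac12\sum_{j=1}^{n-1}b_{j+1,n-j+1}\,C_jC_{n-j}+\frac12 g_2\sum_{j=0}^{n-4}C_jC_{n-4-j}+6\lambda\sum_{j=0}^{n-5}C_jC_{n-5-j} $$ subject to fixing $C_0=1$, $C_1=0$, $C_6=-g_3/840$. Moreover each $C_n$ is a weighted homogeneous polynomial of total degree $n$ in the arguments $g_2,\lambda,g_3$ with weights $4,5,6$ respectively.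
   Context: For complex $g_2,\lambda,g_3$, $u(z)=u(z;g_2,\lambda,g_3)$ denotes the meromorphic solution on $\mathbb{C}$ of $\frac{d^2u}{dz^2}=6u^2-6\lambda z-\frac{g_2}{2}$ with a double pole at $z=0$ whose Laurent expansion there is $u(z)=\sum_{n\ge0}c_nz^{n-2}$ with $c_0=1$ and $c_6=g_3/28$ (all other coefficients are then determined by the differential equation; $c_6$ is the only free coefficient). A tau-function of $u$ is a holomorphic function $\tau$ with $u=-\frac{d^2}{dz^2}\log\tau$; it is defined up to $\tau\to e^{az+b}\tau$, and it has a simple zero at $z=0$. The normalized tau-function is the unique one with $\tau(0)=0$, $\tau'(0)=1$, $\tau''(0)=0$, so $\tau(z)=z+\sum_{n\ge2}C_nz^{n+1}$. The integers $b_{j,k}$ are $b_{j,k}=4!\sum_{\ell=0}^{4}(-1)^\ell\binom{j}{\ell}\binom{k}{4-\ell}$. Sums with upper limit smaller than the lower limit are zero. A polynomial $P(g_2,\lambda,g_3)$ is weighted homogeneous of total degree $n$ with weights $4,5,6$ if $P(\zeta^4g_2,\zeta^5\lambda,\zeta^6g_3)=\zeta^nP(g_2,\lambda,g_3)$ for all $\zeta\in\mathbb{C}^*$ (the zero polynomial is allowed). *)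

(* Defs.v *)
From HB Require Import structures.
From mathcomp Require Import all_boot all_order all_algebra.
From mathcomp Require Import all_classical all_reals all_analysis.
From mathcomp Require Import complex.
(* Not imported: its notations conflict with those of MathComp-Analysis. *)
From mathcomp Require mpoly.

Set Implicit Arguments.
Unset Strict Implicit.
Unset Printing Implicit Defensive.
Import Order.TTheory GRing.Theory Num.Theory.
Import numFieldNormedType.Exports.
Local Open Scope classical_set_scope.
Local Open Scope ring_scope.

(* The analytic notions are written over an arbitrary numFieldType K, on which
   MathComp-Analysis provides the topology of the norm; they are meant for
   K := R[i], where [derivable f z 1] is complex differentiability. *)
Section ComplexAnalysis.
Variable K : numFieldType.
Implicit Types (f u tau : K -> K) (z : K) (a : nat -> K).

Definition holomorphic_at f z : Prop := \forall w \near z, derivable f w 1.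

Definition entire f : Prop := forall z, derivable f z 1.

Definition pole_of_order (k : nat) f z : Prop :=
  [/\ (0 < k)%N & exists h : K -> K,
      [/\ holomorphic_at h z, h z != 0 &
          \forall w \near z^', f w = h w / (w - z) ^+ k]].

(* The value of a total function at one of its poles is irrelevant; removable
   singularities are excluded, so [f] is holomorphic exactly off its poles. *)
Definition meromorphic f : Prop :=
  forall z, holomorphic_at f z \/ exists k, pole_of_order k f z.

Definition taylor_at0 a f : Prop :=
  \forall z \near (0 : K), series (fun n => a n * z ^+ n) @ \oo --> f z.

(* Laurent expansion at 0 with a term of lowest degree -2. *)
Definition laurent2_at0 a f : Prop :=
  \forall z \near (0 : K)^',
    series (fun n => a n * z ^ (n%:Z - 2)) @ \oo --> f z.

Definition painleve1 (g2 la : K) u : Prop :=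
  forall z, holomorphic_at u z ->
    u^`(2)%classic z = 6 * u z ^+ 2 - 6 * la * z - g2 / 2.

Definition painleve1_solution (g2 la g3 : K) u : Prop :=
  [/\ meromorphic u, painleve1 g2 la u, pole_of_order 2 u 0 &
      exists c : nat -> K, [/\ c 0%N = 1, c 6%N = g3 / 28 & laurent2_at0 c u]].

(* The second derivative of the multivalued function log tau is the derivative
   of the single-valued logarithmic derivative tau' / tau. *)
Definition tau_function u tau : Prop :=
  entire tau /\
  forall z, tau z != 0 ->
    u z = - (fun w => tau^`()%classic w / tau w)^`()%classic z.

Definition normalized_tau u tau : Prop :=
  [/\ tau_function u tau, tau 0 = 0, tau^`()%classic 0 = 1
    & tau^`(2)%classic 0 = 0].

(* tau(z) = \sum_n C_n z^(n+1) near 0 *)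
Definition tau_expansion (C : nat -> K) tau : Prop :=
  taylor_at0 (fun n => if n is m.+1 then C m else 0) tau.

End ComplexAnalysis.

Definition b (j k : nat) : int :=
  (4`!)%:Z * \sum_(l < 5) (-1) ^+ l * ('C(j, l) * 'C(k, 4 - l))%:Z.

(* The last two sums run over 0 <= j <= n-4 and 0 <= j <= n-5; with truncated
   subtraction the half-open bounds n-3 and n-4 make them empty for n < 4 and
   n < 5 respectively. *)
Definition tau_recursion (K : numFieldType) (g2 la : K) (C : nat -> K) : Prop :=
  forall n : nat,
    n%:R * (n%:R ^+ 2 - 1) * (n%:R - 6) * C n =
    - (1 / 2) * (\sum_(1 <= j < n) (b j.+1 (n - j).+1)%:~R * C j * C (n - j)%N)
    + 1 / 2 * g2 * (\sum_(0 <= j < n - 3) C j * C (n - 4 - j)%N)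
    + 6 * la * (\sum_(0 <= j < n - 4) C j * C (n - 5 - j)%N).

Definition tau_recursion_from (K : numFieldType) (g2 la g3 : K)
    (C : nat -> K) : Prop :=
  [/\ C 0%N = 1, C 1%N = 0, C 6%N = - g3 / 840 & tau_recursion g2 la C].

(* Value at (x, y, t) of a polynomial in Q[g2, lambda, g3]. *)
Definition eval3 (K : numFieldType) (P : mpoly.mpoly 3 rat) (x y t : K) : K :=
  mpoly.mmap (@ratr K) (fun i : 'I_3 => [:: x; y; t]`_i) P.

Definition weighted_homogeneous (K : numFieldType) (n : nat)
    (P : mpoly.mpoly 3 rat) : Prop :=
  forall zeta x y t : K, zeta != 0 ->
    eval3 P (zeta ^+ 4 * x) (zeta ^+ 5 * y) (zeta ^+ 6 * t) =
    zeta ^+ n * eval3 P x y t.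

(* Main.v *)
Require Import Defs.
From mathcomp Require Import all_boot all_order all_algebra.
From mathcomp Require Import all_classical all_reals all_analysis.
From mathcomp Require Import complex.
From mathcomp Require mpoly.
From mathcomp Require Import ring zify.
Import -(notations) mpoly.

(* Near 0 the power series of tau may be differentiated term by term.  With
   A_k = tau^(k) / tau, so that A_k' = A_{k+1} - A_k A_1, the relation
   u = -(log tau)'' reads u = A_1^2 - A_2, and the equation for u becomes Hirota's
   bilinear form
     tau tau'''' - 4 tau' tau''' + 3 tau''^2 = (6 lambda z + g_2 / 2) tau^2
   on a punctured neighbourhood of 0; comparing coefficients gives the recursion.
   At n = 6 the recursion is void, and C_6 is read off the coefficient of z^8 in
     (z^2 u) tau^2 = (z tau')^2 - tau (z^2 tau'').
   Cauchy products of convergent series are avoided: functions are compared with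
   polynomials modulo O(z^N).
   The recursion defines P_n with rational coefficients.  Homogeneity holds because
   both P_n(zeta^4 x, zeta^5 y, zeta^6 t) and zeta^n P_n(x, y, t) solve the rescaled
   recursion with the same data at n = 0, 1, 6, which determine a solution. *)

Set Implicit Arguments.
Unset Strict Implicit.
Unset Printing Implicit Defensive.
Import Order.TTheory GRing.Theory Num.Theory.
Import numFieldNormedType.Exports.
Local Open Scope classical_set_scope.
Local Open Scope ring_scope.
Local Open Scope complex_scope.

(** * Power series *)

Section PowerSeries.
Variable K : numFieldType.
Implicit Types (a : nat -> K) (f : K -> K) (z w : K).

Lemma sum_geometric_half n : \sum_(0 <= k < n) (2^-1 : K) ^+ k <= 2.
Proof.
suff -> : \sum_(0 <= k < n) (2^-1 : K) ^+ k = 2 - 2 * 2^-1 ^+ n.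
  by rewrite gerBl mulr_ge0 ?exprn_ge0 ?invr_ge0.
elim: n => [|n IHn]; first by rewrite big_geq // expr0; ring.
by rewrite big_nat_recr //= IHn exprS; field.
Qed.

Lemma norm_sum_le_geometric (u : nat -> K) (M : K) n :
  (forall k, `|u k| <= M * 2^-1 ^+ k) -> `|\sum_(0 <= k < n) u k| <= M * 2.
Proof.
move=> uM; have M0 : 0 <= M.
  by apply: le_trans (normr_ge0 (u 0%N)) _; rewrite (le_trans (uM 0%N)) // mulr1.
apply: le_trans (ler_norm_sum _ _ _) _.
apply: le_trans (ler_sum _ (fun k _ => uM k)) _.
by rewrite -mulr_sumr ler_wpM2l // sum_geometric_half.
Qed.

Lemma cvg_norm_le_bound (s : nat -> K) (l c B : K) :
  s @ \oo --> l -> (\forall n \near \oo, `|s n - c| <= B) -> `|l - c| <= B.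
Proof.
move=> /cvgrPdist_le sl sB; apply/ler_addgt0Pr => e e0.
suff [n [ln nB]] : exists n, `|l - s n| <= e /\ `|s n - c| <= B.
  rewrite -(subrK (s n) l) -addrA (le_trans (ler_normD _ _)) // [B + e]addrC.
  exact: lerD.
near \oo => n; exists n; split; near: n => //.
exact: sl.
Unshelve. all: by end_near.
Qed.

(** The terms at one point z != 0 of convergence tend to 0, hence are bounded, and A = 1/|z| works.
    Only a punctured neighbourhood is used, so that the lemma also applies to z^2 u. *)
Lemma coef_geometric_bound a f :
  (\forall z \near (0 : K)^', series (fun n => a n * z ^+ n) @ \oo --> f z) ->
  exists M A : K, [/\ 0 <= M, 0 < A & forall n, `|a n| <= M * A ^+ n].
Proof.
move=> af.
have [z [z0 afz]] :
    exists z, z != 0 /\ series (fun n => a n * z ^+ n) @ \oo --> f z.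
  near (0 : K)^' => z; exists z; split; last by near: z.
  by near: z; exact: nbhs_dnbhs_neq.
have /cvg_series_cvg_0/cvgr0_norm_le/(_ 1 ltr01) [N _ aN] :
  cvgn (series (fun n => a n * z ^+ n)) by apply/cvg_ex; exists (f z).
(* From N on the terms have norm at most 1; the earlier ones are absorbed by their sum. *)
exists (1 + \sum_(0 <= k < N) `|a k * z ^+ k|), `|z|^-1.
have S0 : 0 <= \sum_(0 <= k < N) `|a k * z ^+ k| by rewrite sumr_ge0.
split; [by rewrite addr_ge0|by rewrite invr_gt0 normr_gt0|move=> n].
rewrite exprVn ler_pdivlMr ?exprn_gt0 ?normr_gt0 // -normrX -normrM.
have [Nn|nN] := leqP N n; first by rewrite (le_trans (aN n Nn)) // lerDl.
rewrite (le_trans _ (_ : \sum_(0 <= k < N) `|a k * z ^+ k| <= _)) ?lerDr //.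
rewrite big_mkord (bigD1 (Ordinal nN)) //= lerDl.
by rewrite sumr_ge0.
Unshelve. all: by end_near.
Qed.

(** The tail is dominated by M (A|z|)^N times the geometric series of ratio 1/2, whose sum is at
    most 2. *)
Lemma series_tail_bound a (M A z l : K) N :
  0 <= M -> 0 < A -> (forall n, `|a n| <= M * A ^+ n) -> A * `|z| <= 2^-1 ->
  series (fun n => a n * z ^+ n) @ \oo --> l ->
  `|l - \sum_(0 <= k < N) a k * z ^+ k| <= M * (A * `|z|) ^+ N * 2.
Proof.
move=> M0 A0 aM Az al; apply: cvg_norm_le_bound al _.
exists N => // n /= Nn.
rewrite /series /= (@big_cat_nat _ _ _ N) //= addrAC subrr add0r.
rewrite -{1}(add0n N) big_addn; apply: norm_sum_le_geometric => k.
rewrite normrM normrX addnC -mulrA.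
apply: le_trans (ler_wpM2r _ (aM _)) _; first exact: exprn_ge0.
rewrite -mulrA ler_wpM2l // -exprMn exprD ler_wpM2l //.
  by rewrite exprn_ge0 // mulr_ge0 // ltW.
by rewrite lerXn2r ?qualifE //= ?invr_ge0 // mulr_ge0 // ltW.
Qed.

(** A nonzero z has a full neighbourhood avoiding 0, which is what differentiating an identity valid
    off 0 requires. *)
Lemma near_dnbhs0_near (P : K -> Prop) :
  (\forall z \near (0 : K)^', P z) ->
  \forall z \near (0 : K)^', \forall w \near z, P w.
Proof.
rewrite !near_withinE => /near_join; apply: filterS => z zP z0.
near=> w; apply: (near zP) => //=.
by near: w; apply: (@cvgr_neq0 _ _ _ (nbhs z) _ id z) => //; exact: cvg_id.
Unshelve. all: by end_near.
Qed.

End PowerSeries.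

(** * Functions compared with polynomials modulo O(z^N) at 0 *)

Section Approximation.
Variable K : numFieldType.
Implicit Types (a : nat -> K) (f g : K -> K) (p q : {poly K}) (N : nat).

(** The value at 0 is left out because u has a pole there, and [p] may have degree N or more, so
    that products need no truncation. *)
Definition taylor_approx N p f : Prop :=
  exists2 M : K, 0 <= M & \forall z \near (0 : K)^', `|f z - p.[z]| <= M * `|z| ^+ N.

Lemma near_eq_taylor_approx N p f g :
  (\forall z \near (0 : K)^', f z = g z) -> taylor_approx N p f -> taylor_approx N p g.
Proof.
move=> fg [M M0 pf]; exists M => //; near=> z.
rewrite -(near fg z) //; exact: (near pf z).
Unshelve. all: by end_near.
Qed.

Lemma taylor_approx_horner N p : taylor_approx N p (horner p).
Proof. by exists 0 => //; near=> z; rewrite subrr normr0 mul0r.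
Unshelve. all: by end_near.
Qed.

Lemma taylor_approx_pseries a f N :
  (\forall z \near (0 : K)^', series (fun n => a n * z ^+ n) @ \oo --> f z) ->
  taylor_approx N (\poly_(i < N) a i) f.
Proof.
move=> af; have [M [A [M0 A0 aM]]] := coef_geometric_bound af.
exists (M * A ^+ N * 2); first by rewrite !mulr_ge0 ?exprn_ge0 // ltW.
near=> z.
have Az : A * `|z| <= 2^-1.
  rewrite mulrC -ler_pdivlMr //.
  near: z; apply: dnbhs0_le; by rewrite divr_gt0 ?invr_gt0.
rewrite horner_poly -(big_mkord xpredT (fun i => a i * z ^+ i)).
rewrite mulrAC -[_ * A ^+ N * _]mulrA -exprMn.
exact: (series_tail_bound N M0 A0 aM Az (near af z _)).
Unshelve. all: by end_near.
Qed.

Lemma horner_bounded p :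
  exists2 B : K, 0 <= B & \forall z \near (0 : K)^', `|p.[z]| <= B.
Proof.
exists (\sum_(i < size p) `|p`_i|); first by rewrite sumr_ge0.
near=> z; rewrite horner_coef; apply: le_trans (ler_norm_sum _ _ _) _.
apply: ler_sum => i _; rewrite normrM normrX ler_piMr // exprn_ile1 //.
by near: z; exact: dnbhs0_le.
Unshelve. all: by end_near.
Qed.

Lemma taylor_approxD N p q f g : taylor_approx N p f -> taylor_approx N q g ->
  taylor_approx N (p + q) (fun z => f z + g z).
Proof.
move=> [M M0 pf] [L L0 qg]; exists (M + L); first exact: addr_ge0.
near=> z; rewrite hornerD opprD addrACA mulrDl.
apply: le_trans (ler_normD _ _) _; apply: lerD; first exact: (near pf z).
exact: (near qg z).
Unshelve. all: by end_near.
Qed.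

(** Write fg - pq = (f - p) g + p (g - q), where near 0 |g| is at most L + Bq and |p| at most Bp. *)
Lemma taylor_approxM N p q f g : taylor_approx N p f -> taylor_approx N q g ->
  taylor_approx N (p * q) (fun z => f z * g z).
Proof.
move=> [M M0 pf] [L L0 qg].
have [Bp Bp0 pB] := horner_bounded p; have [Bq Bq0 qB] := horner_bounded q.
exists (M * (L + Bq) + Bp * L); first by rewrite !(addr_ge0, mulr_ge0).
near=> z; rewrite hornerM.
have z1 : `|z| <= 1 by near: z; exact: dnbhs0_le.
have gz : `|g z| <= L + Bq.
  rewrite -(subrK q.[z] (g z)) (le_trans (ler_normD _ _)) // lerD //.
    rewrite (le_trans (near qg z _)) // ler_piMr //.
    exact: exprn_ile1.
  exact: (near qB z).
have -> : f z * g z - p.[z] * q.[z] = (f z - p.[z]) * g z + p.[z] * (g z - q.[z]).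
  by ring.
apply: le_trans (ler_normD _ _) _; rewrite [leRHS]mulrDl !normrM; apply: lerD.
  by rewrite mulrAC; apply: ler_pM => //; exact: (near pf z).
rewrite -mulrA; apply: ler_pM => //; first exact: (near pB z).
exact: (near qg z).
Unshelve. all: by end_near.
Qed.

Lemma norm_le_linear0 (c B : K) :
  0 <= B -> (\forall z \near (0 : K)^', `|c| <= B * `|z|) -> c = 0.
Proof.
move=> B0 cB; apply/eqP; apply: contraT => c0.
have B1 : 0 < B + 1 by rewrite ltr_wpDl.
suff : \forall z \near (0 : K)^', False.
  by move=> /filter_ex[].
near=> z.
have : `|z| < `|c| / (B + 1).
  by near: z; apply: dnbhs0_lt; rewrite divr_gt0 ?normr_gt0.
rewrite ltr_pdivlMr // => zc.
suff : `|c| < `|c| by rewrite ltxx.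
apply: le_lt_trans zc; rewrite (le_trans (near cB z _)) // mulrC.
by rewrite ler_wpM2l // lerDl.
Unshelve. all: by end_near.
Qed.

(** Induction on N with the polynomial written as p X + c: c is O(z), hence 0, and division by z
    leaves p = O(z^N). *)
Lemma taylor_approx0_coef N p i : taylor_approx N p (fun=> 0) -> (i < N)%N -> p`_i = 0.
Proof.
elim: N p i => // N IHN; elim/poly_ind => [|p c _] i [M M0 pM] iN.
  by rewrite coef0.
have [B B0 pB] := horner_bounded p.
have {}pM : \forall z \near (0 : K)^', `|p.[z] * z + c| <= M * `|z| ^+ N.+1.
  by apply: filterS pM => z; rewrite sub0r normrN hornerMXaddC.
have c0 : c = 0.
  apply: (@norm_le_linear0 _ (M + B)); first exact: addr_ge0.
  near=> z.
  have z1 : `|z| <= 1 by near: z; exact: dnbhs0_le.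
  have pz : `|p.[z] * z + c| <= M * `|z| ^+ N.+1.
    exact: (near pM z).
  rewrite -(addKr (p.[z] * z) c) (le_trans (ler_normD _ _)) //.
  rewrite mulrDl [M * _ + _]addrC; apply: lerD.
    by rewrite normrN normrM ler_wpM2r //; exact: (near pB z).
  rewrite (le_trans pz) // exprS ler_wpM2l // ler_piMr //.
  exact: exprn_ile1.
rewrite c0 addr0 coefMX; case: i iN => //= i iN.
apply: IHN iN; exists M => //; near=> z.
have z0 : 0 < `|z| by rewrite normr_gt0; near: z; exact: nbhs_dnbhs_neq.
rewrite -(ler_pM2r z0) -mulrA -exprSr sub0r normrN -normrM -[_ * z]addr0.
by rewrite -[X in _ + X]c0; exact: (near pM z).
Unshelve. all: by end_near.
Qed.

(** The passage from identities of functions off 0 to identities of coefficients. *)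
Lemma taylor_approx_inj N p q f g i :
  taylor_approx N p f -> taylor_approx N q g ->
  (\forall z \near (0 : K)^', f z = g z) -> (i < N)%N -> p`_i = q`_i.
Proof.
move=> pf qg fg iN; apply/eqP; rewrite -subr_eq0 -coefB; apply/eqP.
apply: taylor_approx0_coef iN.
apply: (@near_eq_taylor_approx _ _ (fun z => f z + ((-1)%:P : {poly K}).[z] * g z)).
  near=> z; rewrite hornerC (near fg z) //; ring.
have -> : p - q = p + (-1)%:P * q by rewrite polyCN mulN1r.
exact/taylor_approxD/taylor_approxM/qg/taylor_approx_horner.
Unshelve. all: by end_near.
Qed.

End Approximation.

(** * Differentiability from a quadratic remainder estimate *)

Section TermwiseDerivative.
Variable K : numFieldType.
Implicit Types (a : nat -> K) (f : K -> K) (z w : K).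

(** The difference quotient with increment h differs from L by at most C |h|. *)
Lemma is_derive_quadratic f z (L C : K) : 0 <= C ->
  (\forall w \near z, `|f w - f z - (w - z) * L| <= C * `|w - z| ^+ 2) ->
  is_derive z 1 f L.
Proof.
move=> C0 fL.
suff cv : (h^-1 *: ((f \o shift z) (h *: 1) - f z)) @[h --> (0 : K)^'] --> L.
  by split; [apply/cvg_ex; exists L|apply: cvg_lim cv; exact: norm_hausdorff].
apply/cvgrPdist_le => e e0.
have C1 : 0 < C + 1 by rewrite ltr_wpDl.
have fLh : \forall h \near (0 : K), `|f (h + z) - f z - h * L| <= C * `|h| ^+ 2.
  move: fL; rewrite (near_shift 0) /=; apply: filterS => h /=.
  by rewrite subr0 addrK.
near=> h.
have h0 : h != 0 by near: h; exact: nbhs_dnbhs_neq.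
have hn0 : 0 < `|h| by rewrite normr_gt0.
rewrite /= scaler1 distrC -(ler_pM2l hn0) -normrM mulrBr.
rewrite -[h^-1 *: _]/(h^-1 * _) mulrA divff // mul1r.
have /le_trans -> // : `|f (h + z) - f z - h * L| <= C * `|h| ^+ 2.
  by near: h; exact: nbhs_dnbhs.
rewrite expr2 mulrA mulrC ler_wpM2l //.
have : `|h| <= e / (C + 1) by near: h; apply: dnbhs0_le; rewrite divr_gt0.
rewrite ler_pdivlMr // => he; apply: le_trans he.
by rewrite mulrC ler_wpM2l // lerDl.
Unshelve. all: by end_near.
Qed.

(** A crude bound, but geometric in k, so that it can be summed against coefficients of geometric
    growth. The induction splits off w times the previous remainder and uses k <= 2^k for the
    rest. *)
Lemma exprn_quadratic_bound (r z w : K) k : 0 < r -> `|z| <= r -> `|w| <= r ->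
  `|w ^+ k - z ^+ k - (w - z) * (k%:R * z ^+ k.-1)|
    <= `|w - z| ^+ 2 * ((2 * r) ^+ k / r ^+ 2).
Proof.
move=> r0 zr wr; elim: k => [|k IHk].
  rewrite mul0r mulr0 !expr0 !subrr normr0 mul1r.
  by rewrite mulr_ge0 ?exprn_ge0 ?invr_ge0 ?exprn_ge0 // ltW.
have -> : w ^+ k.+1 - z ^+ k.+1 - (w - z) * (k.+1%:R * z ^+ k.+1.-1) =
    w * (w ^+ k - z ^+ k - (w - z) * (k%:R * z ^+ k.-1)) +
    (w - z) ^+ 2 * (k%:R * z ^+ k.-1).
  case: k {IHk} => [|k]; first by rewrite expr0; ring.
  by rewrite -[k.+2%:R]natr1 !exprS /=; ring.
apply: le_trans (ler_normD _ _) _.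
rewrite normrM [`|_ ^+ 2 * _|]normrM normrX [`|_%:R * _|]normrM normr_nat.
rewrite [`|z ^+ _|]normrX.
apply: (@le_trans _ _ (r * (`|w - z| ^+ 2 * ((2 * r) ^+ k / r ^+ 2)) +
    `|w - z| ^+ 2 * ((2 * r) ^+ k * r / r ^+ 2))); last first.
  by rewrite [(2 * r) ^+ k.+1]exprS le_eqVlt; apply/orP; left; apply/eqP; ring.
apply: lerD; first exact: ler_pM.
rewrite ler_wpM2l ?exprn_ge0 //.
case: k {IHk} => [|k].
  by rewrite mul0r !mulr_ge0 ?invr_ge0 ?exprn_ge0 ?mulr_ge0 // ltW.
have -> : (2 * r) ^+ k.+1 * r / r ^+ 2 = 2 ^+ k.+1 * r ^+ k.
  by rewrite exprMn !exprS expr0; field; rewrite gt_eqF.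
apply: ler_pM => //; rewrite ?exprn_ge0 //.
  by rewrite -natrX ler_nat ltnW // ltn_expl.
by rewrite lerXn2r ?qualifE //= ltW.
Qed.

End TermwiseDerivative.

(** * Convergence of complex series dominated by a geometric series *)

Section ComplexSeries.
Variable R : realType.
Local Notation C := (R[i] : numFieldType).
Implicit Types (a : nat -> C) (f : C -> C) (u : nat -> C).

Lemma is_cvg_series_Re_geometric u (M : C) :
  (forall n, `|u n| <= M * 2^-1 ^+ n) -> cvgn (series (fun n => complex.Re (u n))).
Proof.
move=> uM; have M0 : 0 <= M.
  by apply: le_trans (normr_ge0 (u 0%N)) _; rewrite (le_trans (uM 0%N)) // mulr1.
apply: normed_cvg.
apply: (@series_le_cvg _ _ (geometric (complex.Re M) (2^-1))) => //.
- by move=> n /=.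
- move=> n /=; rewrite mulr_ge0 ?exprn_ge0 ?invr_ge0 //.
  by case: (M) M0 => x y /= /andP[].
- move=> n /=; rewrite -lecR; apply: le_trans (normc_ge_Re _) _.
  apply: le_trans (uM n) _.
  by rewrite rmorphM rmorphXn fmorphV rmorph_nat /= RRe_real // ger0_real.
- apply: is_cvg_geometric_series.
  by rewrite ger0_norm ?invr_ge0 // invf_lt1 // ltr1n.
Qed.

(** Convergence is obtained in R for the real and imaginary parts separately, the latter through Im
    u = - Re (i u). *)
Lemma is_cvg_series_geometric u (M : C) :
  (forall n, `|u n| <= M * 2^-1 ^+ n) -> cvgn (series u).
Proof.
move=> uM.
have ni : `|'i%C : R[i]| = 1.
  by rewrite normc_def /= expr0n expr1n add0r sqrtr1.
have iuM n : `|u n * 'i%C| <= M * 2^-1 ^+ n.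
  by rewrite normrM ni mulr1.
have /cvg_ex[x /cvgrPdist_le ux] := is_cvg_series_Re_geometric uM.
have /cvg_ex[y /cvgrPdist_le uy] := is_cvg_series_Re_geometric iuM.
apply/cvg_ex; exists (x%:C - 'i%C * y%:C); apply/cvgrPdist_le => e e0.
have eE : e = (complex.Re e)%:C by rewrite RRe_real // gtr0_real.
have e20 : 0 < complex.Re e / 2 by rewrite divr_gt0 // -ltcR -eE.
have sE n : series u n = (series (fun k => complex.Re (u k)) n)%:C
    - 'i%C * (series (fun k => complex.Re (u k * 'i%C)) n)%:C.
  rewrite /series /= !rmorph_sum /= mulr_sumr -sumrB; apply: eq_bigr => k _.
  by rewrite ReiNIm {1}[u k]complexE rmorphN mulrN opprK.
have nR (t : R) : `|t%:C| = `|t|%:C.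
  by rewrite normc_def /= expr0n addr0 sqrtr_sqr.
near=> n; rewrite sE.
set s := series _ n; set t := series _ n.
have -> : x%:C - 'i%C * y%:C - (s%:C - 'i%C * t%:C) = (x - s)%:C - 'i%C * (y - t)%:C.
  by rewrite !rmorphB /=; ring.
apply: le_trans (ler_normB _ _) _.
rewrite normrM ni mul1r !nR.
rewrite {}/s {}/t -rmorphD eE lecR [leRHS]splitr; apply: lerD.
  by near: n; exact: ux.
by near: n; exact: uy.
Unshelve. all: by end_near.
Qed.

End ComplexSeries.

(** * Term-by-term differentiation of complex power series *)

Section ComplexTaylor.
Variable R : realType.
Local Notation C := (R[i] : numFieldType).
Implicit Types (a : nat -> C) (f : C -> C).

(** With L the sum of the derived series, the partial sums of f(w) - f(z) - (w - z) L are bounded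
    termwise by [exprn_quadratic_bound], and the bound survives the limit. *)
Lemma taylor_at0_is_derive a f : taylor_at0 a f ->
  \forall z \near (0 : C), derivable f z 1 /\
    series (fun n => n.+1%:R * a n.+1 * z ^+ n) @ \oo --> f^`()%classic z.
Proof.
move=> af; have [M [A [M0 A0 aM]]] := coef_geometric_bound (nbhs_dnbhs af).
(* Now A (2r) = 1/2: the factor n + 1 <= 2^n of the derived series and the factor (2r)^k of the
   remainder bound both leave ratio 1/2. *)
pose r : C := (4 * A)^-1.
have r0 : 0 < r by rewrite invr_gt0 mulr_gt0.
have Ar : A * (2 * r) = 2^-1 by rewrite /r; field; rewrite gt_eqF.
have near_r : \forall z \near (0 : C), `|z| < r.
  exact: nbhs0_lt.
near=> z.
have zr : `|z| <= r by apply: ltW; near: z.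
have /cvg_ex[L zL] : cvgn (series (fun n => n.+1%:R * a n.+1 * z ^+ n)).
  apply: (@is_cvg_series_geometric _ _ (M * A)) => n.
  rewrite -Ar !exprMn normrM normrX normrM normr_nat.
  have -> : M * A * (A ^+ n * (2 ^+ n * r ^+ n)) =
      2 ^+ n * (M * A ^+ n.+1) * r ^+ n by rewrite exprS; ring.
  apply: ler_pM; rewrite ?mulr_ge0 ?exprn_ge0 //; last first.
    by rewrite lerXn2r ?qualifE //= ltW.
  have n2 : n.+1%:R <= 2 ^+ n :> C by rewrite -natrX ler_nat ltn_expl.
  by apply: ler_pM; rewrite ?normr_ge0 //; exact: aM.
have zf : is_derive z 1 f L.
  apply: (@is_derive_quadratic _ _ _ _ (M * 2 / r ^+ 2)).
    by rewrite !mulr_ge0 // invr_ge0 exprn_ge0 // ltW.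
  near=> w.
  have wr : `|w| <= r.
    by apply: ltW; near: w; exact: (near (near_join near_r) z).
  (* One more term than in the derived series, whose first n terms come from the indices 1 to n of
     f. *)
  have fz : series (fun n => a n * z ^+ n) n.+1 @[n --> \oo] --> f z.
    by rewrite cvg_shiftS; near: z.
  have fw : series (fun n => a n * w ^+ n) n.+1 @[n --> \oo] --> f w.
    by rewrite cvg_shiftS; near: w; exact: (near (near_join af) z).
  rewrite -[f w - f z - _]subr0.
  apply: cvg_norm_le_bound (cvgB (cvgB fw fz) (cvgM (cvg_cst (w - z)) zL)) _.
  near=> n; rewrite subr0 [X in `|X|](_ : _ = \sum_(0 <= k < n.+1)
      a k * (w ^+ k - z ^+ k - (w - z) * (k%:R * z ^+ k.-1))); last first.
    transitivity (\sum_(0 <= k < n.+1) a k * w ^+ k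
      - \sum_(0 <= k < n.+1) a k * z ^+ k
      - (w - z) * \sum_(0 <= k < n) k.+1%:R * a k.+1 * z ^+ k); first by [].
    rewrite !big_nat_recl //= !expr0 mulr0n mul0r mulr0 !subr0 subrr mulr0 add0r.
    rewrite opprD addrACA subrr add0r mulr_sumr -!sumrB; apply: eq_bigr => k _.
    by ring.
  have -> : M * 2 / r ^+ 2 * `|w - z| ^+ 2 = M / r ^+ 2 * `|w - z| ^+ 2 * 2.
    by ring.
  apply: norm_sum_le_geometric => k.
  rewrite normrM -Ar exprMn.
  have -> : M / r ^+ 2 * `|w - z| ^+ 2 * (A ^+ k * (2 * r) ^+ k) =
    M * A ^+ k * (`|w - z| ^+ 2 * ((2 * r) ^+ k / r ^+ 2)) by ring.
  apply: ler_pM => //; exact: exprn_quadratic_bound.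
split; first by case: zf.
by have -> : f^`()%classic z = L by rewrite derive1E; case: zf.
Unshelve. all: by end_near.
Qed.

Lemma taylor_at0_derive1n a f k : taylor_at0 a f ->
  taylor_at0 (fun n => ((n + k) ^_ k)%:R * a (n + k)%N) (f^`(k)%classic) /\
  \forall z \near (0 : C),
    is_derive (z : C) (1 : C) (f^`(k)%classic) (f^`(k.+1)%classic z).
Proof.
move=> af.
have afk : taylor_at0 (fun n => ((n + k) ^_ k)%:R * a (n + k)%N) (f^`(k)%classic).
  elim: k => [|k IHk].
    have -> // : (fun n => ((n + 0) ^_ 0)%:R * a (n + 0)%N) = a.
    by apply/funext => n; rewrite addn0 mul1r.
  have -> : (fun n => ((n + k.+1) ^_ k.+1)%:R * a (n + k.+1)%N) =
      (fun n => n.+1%:R * (((n.+1 + k) ^_ k)%:R * a (n.+1 + k)%N)).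
    by apply/funext => n; rewrite -addSnnS ffactnSr addnK natrM; ring.
  by apply: filterS (taylor_at0_is_derive IHk) => z [_]; rewrite -derive1nS.
split=> //; apply: filterS (taylor_at0_is_derive afk) => z [? _].
by rewrite derive1nS derive1E; exact: derivableP.
Qed.

End ComplexTaylor.

(** * The recursion and its polynomial solution *)

Section Recursion.
Variable K : numFieldType.
Implicit Types (C D a : nat -> K) (g la : K) (n m : nat).

(** The Taylor coefficients of tau itself, where C_n belongs to z^(n+1). *)
Definition shift_seq C n := if n is m.+1 then C m else 0.

Definition autoconv a n := \sum_(j < n.+1) a j * a (n - j)%N.

(** Both end terms vanish because tau has no constant term. The weight [F] is either [b] or the
    constant 1. *)
Lemma sum_shift_seq (F : nat -> nat -> K) C m :
  \sum_(j < m.+3) F j (m.+2 - j)%N * (shift_seq C j * shift_seq C (m.+2 - j)) =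
  \sum_(j < m.+1) F j.+1 (m - j).+1 * (C j * C (m - j)%N).
Proof.
rewrite big_ord_recl mul0r mulr0 add0r big_ord_recr /= subnn mulr0 mulr0 addr0.
apply: eq_bigr => j _; have jm : (j <= m)%N by rewrite -ltnS.
by rewrite /= /bump leq0n add1n subSS subSn.
Qed.

Lemma autoconv_shift_seq C m :
  autoconv (shift_seq C) m = \sum_(0 <= j < m.-1) C j * C (m - 2 - j)%N.
Proof.
case: m => [|[|m]].
- by rewrite /autoconv big_ord1 mul0r big_geq.
- by rewrite /autoconv !big_ord_recr big_ord0 /= mulr0 mul0r !addr0 big_geq.
- rewrite big_mkord subn2 /=.
  have := sum_shift_seq (fun _ _ => 1) C m.
  rewrite (eq_bigr _ (fun _ _ => mul1r _)) /autoconv => ->.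
  by apply: eq_bigr => j _; rewrite mul1r.
Qed.

(* The coefficients of the Hirota derivative D^4 (z^j . z^k). *)
Lemma bE j k : (b j k)%:~R = (k ^_ 4)%:R - 4 * ((j ^_ 1)%:R * (k ^_ 3)%:R)
  + 6 * ((j ^_ 2)%:R * (k ^_ 2)%:R) - 4 * ((j ^_ 3)%:R * (k ^_ 1)%:R)
  + (j ^_ 4)%:R :> K.
Proof.
rewrite /b !big_ord_recr big_ord0 /= -!bin_ffact !factS fact0.
have -> : (-1) ^+ 2 = 1 :> int by [].
have -> : (-1) ^+ 3 = -1 :> int by [].
have -> : (-1) ^+ 4 = 1 :> int by [].
rewrite expr0 expr1 !mulN1r !mul1r !(intrM, intrD, intrN) -!pmulrn !natrM !bin0.
by ring.
Qed.

(** Subtraction in K may replace the truncated one, since for n < m both sides vanish; [ring] can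
    then handle falling factorials. *)
Lemma natr_ffactSr n m : (n ^_ m.+1)%:R = (n ^_ m)%:R * (n%:R - m%:R) :> K.
Proof.
rewrite ffactnSr natrM; have [mn|nm] := leqP m n; first by rewrite natrB.
by rewrite ffact_small // !mul0r.
Qed.

(** The weight of C_0 C_n in the bilinear form is the left-hand factor of the recursion. *)
Lemma b1 n : (b 1 n.+1)%:~R = n%:R * (n%:R ^+ 2 - 1) * (n%:R - 6) :> K.
Proof. by rewrite bE !natr_ffactSr !ffactn0 -natr1; ring. Qed.

End Recursion.

(** The Hirota derivative D^4 has even order, so exchanging its two arguments changes nothing. *)
Lemma b_sym j k : b j k = b k j.
Proof. by apply: (@intr_inj rat); rewrite !bE; ring. Qed.

Section RecursionStep.
Implicit Types (n m : nat).

Definition tau_coef (L : pzRingType) n : L := n%:R * (n%:R ^+ 2 - 1) * (n%:R - 6).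

(** [half] is a parameter because the step is also taken over a polynomial ring, where 1/2 is a
    constant polynomial. *)
Definition tau_step (L : comPzRingType) (half g la : L) n (C : nat -> L) : L :=
  - half * (\sum_(1 <= j < n) (b j.+1 (n - j).+1)%:~R * C j * C (n - j)%N)
  + half * g * (\sum_(0 <= j < n - 3) C j * C (n - 4 - j)%N)
  + 6 * la * (\sum_(0 <= j < n - 4) C j * C (n - 5 - j)%N).

(* The indices where tau_coef vanishes, so that the recursion leaves C_n free. *)
Definition free_index n := [|| n == 0, n == 1 | n == 6]%N.

(** The factorization n(n-1)(n+1)(n-6), in characteristic 0. *)
Lemma tau_coef_neq0 (K : numFieldType) n : ~~ free_index n -> tau_coef K n != 0.
Proof.
rewrite /free_index !negb_or => /and3P[n0 n1 n6].
have -> : tau_coef K n = n%:R * (n%:R - 1%:R) * n.+1%:R * (n%:R - 6%:R).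
  by rewrite /tau_coef -natr1; ring.
by rewrite !mulf_neq0 ?subr_eq0 ?eqr_nat ?pnatr_eq0.
Qed.

(** Only indices below n occur in the three sums, so the recursion is well founded. *)
Lemma eq_tau_step (L : comPzRingType) (half g la : L) n (C D : nat -> L) :
  (forall k, (k < n)%N -> C k = D k) ->
  tau_step half g la n C = tau_step half g la n D.
Proof.
move=> CD; rewrite /tau_step; congr (_ * _ + _ * _ + _ * _);
  apply: eq_big_nat => j /andP[j0 jn]; rewrite !CD //; lia.
Qed.

Lemma rmorph_tau_step (L L' : comPzRingType) (e : {rmorphism L -> L'})
    (half g la : L) n (C : nat -> L) :
  e (tau_step half g la n C) = tau_step (e half) (e g) (e la) n (e \o C).
Proof.
rewrite /tau_step !(rmorphD, rmorphM, rmorphN, rmorph_nat, rmorph_sum) /=.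
congr (_ * _ + _ * _ + _ * _); apply: eq_bigr => j _;
  by rewrite !rmorphM ?rmorph_int.
Qed.

(** The indices in the three sums add up to n, n-4 and n-5; the factors z^4 and z^5 make up the
    difference. *)
Lemma tau_step_homogeneous (L : comPzRingType) (half g la z : L) n (C : nat -> L) :
  tau_step half (z ^+ 4 * g) (z ^+ 5 * la) n (fun k => z ^+ k * C k) =
  z ^+ n * tau_step half g la n C.
Proof.
have sum0 : \sum_(1 <= j < n) (b j.+1 (n - j).+1)%:~R * (z ^+ j * C j)
      * (z ^+ (n - j) * C (n - j)%N) =
    z ^+ n * \sum_(1 <= j < n) (b j.+1 (n - j).+1)%:~R * C j * C (n - j)%N.
  rewrite mulr_sumr; apply: eq_big_nat => j /andP[_ jn].
  have -> : z ^+ n = z ^+ j * z ^+ (n - j) by rewrite -exprD subnKC // ltnW.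
  by ring.
have sumE i : z ^+ i.+1 * \sum_(0 <= j < n - i) z ^+ j * C j
      * (z ^+ (n - i.+1 - j) * C (n - i.+1 - j)%N) =
    z ^+ n * \sum_(0 <= j < n - i) C j * C (n - i.+1 - j)%N.
  rewrite !mulr_sumr; apply: eq_big_nat => j /andP[_ jn].
  have -> : z ^+ n = z ^+ i.+1 * z ^+ j * z ^+ (n - i.+1 - j).
    by rewrite -!exprD; congr (_ ^+ _); lia.
  by ring.
have mulE x y c s s' : x * s = z ^+ n * s' ->
    c * (x * y) * s = z ^+ n * (c * y * s').
  move=> xs; have -> : c * (x * y) * s = c * y * (x * s) by ring.
  by rewrite xs; ring.
by rewrite /tau_step sum0 (mulE _ _ _ _ _ (sumE 3)) (mulE _ _ _ _ _ (sumE 4)); ring.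
Qed.

Lemma tau_recursion_unique (K : numFieldType) (g la : K) (C D : nat -> K) :
  (forall n, free_index n -> C n = D n) ->
  (forall n, ~~ free_index n -> tau_coef K n * C n = tau_step (1 / 2) g la n C) ->
  (forall n, ~~ free_index n -> tau_coef K n * D n = tau_step (1 / 2) g la n D) ->
  C =1 D.
Proof.
move=> CD0 CR DR; elim/ltn_ind => n IHn.
have [/CD0//|nf] := boolP (free_index n).
apply: (mulfI (tau_coef_neq0 K nf)); rewrite CR // DR //.
exact: eq_tau_step.
Qed.

(** Since tau^2 starts at z^2, its index n+2 corresponds to level n of the recursion; i = 3 and i =
    4 give the last two sums. *)
Lemma autoconv_shift_seq_sub (K : numFieldType) (C : nat -> K) n i :
  (if (n.+2 < i.+1)%N then 0 else autoconv (shift_seq C) (n.+2 - i.+1)) =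
  \sum_(0 <= j < n - i) C j * C (n - i.+1 - j)%N.
Proof.
case: ltnP => ni; first by rewrite big_geq //; lia.
rewrite autoconv_shift_seq; have -> : (n.+2 - i.+1).-1 = (n - i)%N by lia.
by apply: eq_big_nat => j _; congr (_ * C _); lia.
Qed.

(** The coefficient of z^(n+2) gives the recursion at n: by symmetry of [b] each of its two end
    terms is n(n^2-1)(n-6) C_n, whence the halves on the right. *)
Lemma tau_recursion_of_bilinear (K : numFieldType) (g la : K) (C : nat -> K) :
  C 0%N = 1 ->
  (forall m, \sum_(j < m.+1) (b j (m - j))%:~R
      * (shift_seq C j * shift_seq C (m - j)%N) =
    g * (if (m < 4)%N then 0 else autoconv (shift_seq C) (m - 4))
    + 12 * la * (if (m < 5)%N then 0 else autoconv (shift_seq C) (m - 5))) ->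
  tau_recursion g la C.
Proof.
(* Here t is either end term and S the middle sum. *)
have linear_solve (t S A B : K) : t + (S + t) = g * A + 12 * la * B ->
    t = - (1 / 2) * S + 1 / 2 * g * A + 6 * la * B.
  move=> h; have -> : t = 1 / 2 * ((t + (S + t)) - S) by field.
  by rewrite h; field.
(* At n = 0 the two end terms would coincide, but there the recursion reads 0 = 0. *)
move=> C0 bil [|n]; first by rewrite !big_geq // !mulr0 !mul0r !addr0.
have := bil n.+3; rewrite (sum_shift_seq (fun j k => (b j k)%:~R)).
rewrite big_ord_recl big_ord_recr /= subn0 subnn C0.
rewrite (autoconv_shift_seq_sub C n.+1 3) (autoconv_shift_seq_sub C n.+1 4).
rewrite -[bump 0 n]/n.+1 (b_sym n.+2 1) b1 mulr1 mul1r.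
rewrite [X in _ + (X + _)](_ : _ =
    \sum_(1 <= j < n.+1) (b j.+1 (n.+1 - j).+1)%:~R * C j * C (n.+1 - j)%N).
  exact: linear_solve.
by rewrite big_add1 big_mkord; apply: eq_bigr => j _; rewrite mulrA.
Qed.

End RecursionStep.

(** Under iteration of F the value at n is stable after n + 1 rounds, so the diagonal of the
    iterates is a fixed point. *)
Lemma strong_recursion (T : Type) (x0 : T) (F : nat -> (nat -> T) -> T) :
  (forall n f g, (forall k, (k < n)%N -> f k = g k) -> F n f = F n g) ->
  exists f, forall n, f n = F n f.
Proof.
move=> loc; pose G (f : nat -> T) := F ^~ f; pose h m := iter m G (fun=> x0).
have stab n m : (n < m)%N -> h m n = h n.+1 n.
  elim/ltn_ind: n m => n IHn [//|m] nm; apply: loc => k kn.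
  exact: etrans (IHn k kn m (leq_trans kn nm)) (esym (IHn k kn n kn)).
exists (fun n => h n.+1 n) => n; apply: loc => k kn.
exact: stab.
Qed.

(** * The universal polynomials P_n and their homogeneity *)

Section TauPolynomials.

(** The variables 0, 1, 2 stand for g_2, lambda, g_3. Division by the leading factor is
    multiplication by a rational constant. *)
Definition tau_family (P : nat -> mpoly 3 rat) : Prop :=
  [/\ P 0%N = 1, P 1%N = 0, P 6%N = mpolyC 3 (-1 / 840) * mpolyX rat (mnm1 2%:R) &
   forall n, ~~ free_index n -> P n = mpolyC 3 (tau_coef rat n)^-1 *
     tau_step (mpolyC 3 (1 / 2)) (mpolyX rat (mnm1 0)) (mpolyX rat (mnm1 1)) n P].

Lemma tau_polynomials : exists P, tau_family P.
Proof.
pose F n (P : nat -> mpoly 3 rat) : mpoly 3 rat :=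
  if n == 0%N then 1 else if n == 1%N then 0 else
  if n == 6%N then mpolyC 3 (-1 / 840) * mpolyX rat (mnm1 2%:R) else
  mpolyC 3 (tau_coef rat n)^-1 *
  tau_step (mpolyC 3 (1 / 2)) (mpolyX rat (mnm1 0)) (mpolyX rat (mnm1 1)) n P.
have [|P PF] := @strong_recursion _ 0 F.
  by move=> n P Q PQ; rewrite /F (eq_tau_step _ _ _ PQ).
exists P; split; rewrite ?PF // => n.
by rewrite /free_index PF /F !negb_or => /and3P[/negPf-> /negPf-> /negPf->].
Qed.

(** Evaluation is a ring morphism, so it carries the polynomial recursion to the numerical one. *)
Lemma eval3_tau (K : numFieldType) (P : nat -> mpoly 3 rat) (x y t : K) :
  tau_family P ->
  [/\ eval3 (P 0%N) x y t = 1, eval3 (P 1%N) x y t = 0,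
      eval3 (P 6%N) x y t = - t / 840 &
      forall n, ~~ free_index n -> tau_coef K n * eval3 (P n) x y t =
        tau_step (1 / 2) x y n (fun k => eval3 (P k) x y t)].
Proof.
move=> [P0 P1 P6 PS].
pose e : {rmorphism mpoly 3 rat -> K} :=
  mmap (@ratr K) (fun i : 'I_3 => [:: x; y; t]`_i).
have eE Q : eval3 Q x y t = e Q by [].
have eC q : e (mpolyC 3 q) = ratr q by exact: mmapC.
have eX i : e (mpolyX rat (mnm1 i)) = [:: x; y; t]`_i by rewrite [LHS]mmapX mmap1U.
have eNV m : ratr (-1 / m%:R) = -1 / m%:R :> K.
  by rewrite fmorph_div rmorphN rmorph1 rmorph_nat.
rewrite !eE P0 P1 P6 rmorph1 rmorph0 rmorphM eC eX /=; split => //.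
  by rewrite eNV mulrAC mulN1r.
have eS n : ratr (tau_coef rat n) = tau_coef K n.
  by rewrite /tau_coef !(rmorphM, rmorphB, rmorphXn, rmorph_nat, rmorph1).
have e2 : ratr (1 / 2) = 1 / 2 :> K by rewrite fmorph_div rmorph1 rmorph_nat.
move=> n nf; rewrite eE PS // rmorphM eC fmorphV /= eS.
rewrite rmorph_tau_step !eX eC e2 /=.
by rewrite mulVKf ?tau_coef_neq0.
Qed.

Lemma tau_polynomials_homogeneous (K : numFieldType) (P : nat -> mpoly 3 rat) :
  tau_family P ->
  forall n, weighted_homogeneous K n (P n).
Proof.
move=> PP n z x y t z0; move: n.
have [D0 D1 D6 DS] := eval3_tau (z ^+ 4 * x) (z ^+ 5 * y) (z ^+ 6 * t) PP.
have [E0 E1 E6 ES] := eval3_tau x y t PP.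
apply: (tau_recursion_unique _ DS).
  move=> n /or3P[] /eqP ->; first by rewrite D0 E0 mul1r.
    by rewrite D1 E1 mulr0.
  by rewrite D6 E6; ring.
by move=> n nf; rewrite tau_step_homogeneous -ES //; ring.
Qed.

End TauPolynomials.

(** * Bilinear form of the first Painleve equation *)

Section LogarithmicDerivative.
Variable K : numFieldType.

Lemma is_derive_div (f g : K -> K) (z df dg : K) :
  is_derive z 1 f df -> is_derive z 1 g dg -> g z != 0 ->
  is_derive z 1 (fun w => f w / g w) (df / g z - f z / g z * (dg / g z)).
Proof.
move=> fz gz g0.
have gV : is_derive z 1 (fun w => (g w)^-1) (- (g z) ^- 2 *: dg).
  split; first by apply: derivableV => //; case: gz.
  by rewrite deriveV //; case: gz => _ ->.
apply: (@is_derive_eq _ _ _ _ _ _ _ _ (is_deriveM fz gV)).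
by rewrite -![_ *: _]/(_ * _); field.
Qed.

Variables (T : nat -> K -> K) (u : K -> K).
Hypothesis uT : forall w, T 0 w != 0 -> u w = - (fun v => T 1 v / T 0 v)^`()%classic w.

Let A k w := T k w / T 0 w.
Let regular w :=
  T 0 w != 0 /\ forall k, (k < 4)%N -> is_derive w 1 (T k) (T k.+1 w).

Let is_derive_A k w : (k < 4)%N -> regular w ->
  is_derive w 1 (A k) (A k.+1 w - A k w * A 1 w).
Proof. by move=> k4 [T0 TS]; apply: is_derive_div => //; exact: TS. Qed.

Let u_A w : regular w -> u w = A 1 w ^+ 2 - A 2 w.
Proof.
move=> rw; rewrite uT; last by case: rw.
have [_ Dw] := @is_derive_A 1 w isT rw; rewrite derive1E -/(A 1) Dw; ring.
Qed.

Let is_derive_u z : (\forall w \near z, regular w) ->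
  is_derive z 1 u (3 * (A 1 z * A 2 z) - 2 * (A 1 z * (A 1 z * A 1 z)) - A 3 z).
Proof.
move=> rz; have r := nbhs_singleton rz.
apply: (@near_eq_is_derive _ _ _ (A 1 * A 1 - A 2)).
  by apply: filterS rz => w rw; rewrite u_A.
have DA k (k4 : (k < 4)%N) := is_derive_A k4 r.
have := is_deriveB (is_deriveM (DA 1%N isT) (DA 1%N isT)) (DA 2%N isT).
by move/is_derive_eq; apply; rewrite -![_ *: _]/(_ * _); ring.
Qed.

(** In u'' - 6u^2 the terms A_1^4 and A_1^2 A_2 cancel, leaving -(A_4 - 4 A_1 A_3 + 3 A_2^2); the
    factor T_0^2 clears denominators. Holomorphy is included because the equation for u is given
    only where u is holomorphic. *)
Lemma log_derivative_bilinear z : (\forall w \near z, regular w) ->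
  [/\ holomorphic_at u z,
      u z * (T 0 z * T 0 z) = T 1 z * T 1 z - T 0 z * T 2 z &
      (u^`(2)%classic z - 6 * u z ^+ 2) * (T 0 z * T 0 z) =
      - (T 0 z * T 4 z - 4 * (T 1 z * T 3 z) + 3 * (T 2 z * T 2 z))].
Proof.
move=> rz; have r := nbhs_singleton rz; have T0 := r.1.
(* The formula for u' thus holds around z and can be differentiated again. *)
have near_u := near_join rz.
split.
- by apply: filterS near_u => w /is_derive_u[].
- by rewrite u_A // /A; field.
have DA k (k4 : (k < 4)%N) := is_derive_A k4 r.
have [_ u2] : is_derive z 1 (u^`()%classic)
   (3 * A 2 z ^+ 2 - 12 * A 1 z ^+ 2 * A 2 z + 4 * A 1 z * A 3 z + 6 * A 1 z ^+ 4
    - A 4 z).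
  apply: (@near_eq_is_derive _ _ _
    (3 \*: (A 1 * A 2) - 2 \*: (A 1 * (A 1 * A 1)) - A 3)).
    by apply: filterS near_u => w /is_derive_u[_]; rewrite derive1E => ->.
  have := is_deriveB (is_deriveB
    (is_deriveZ 3 (is_deriveM (DA 1%N isT) (DA 2%N isT)))
    (is_deriveZ 2 (is_deriveM (DA 1%N isT)
      (is_deriveM (DA 1%N isT) (DA 1%N isT))))) (DA 3%N isT).
  move/is_derive_eq; apply.
  rewrite -![_ *: _]/(_ * _) -![(A 1 * A 1) z]/(A 1 z * A 1 z).
  by ring.
by rewrite derive1nS derive1n1 derive1E u2 u_A // /A; field.
Qed.

End LogarithmicDerivative.

(** * Comparison of coefficients in the bilinear identities *)

Section TauCoefficients.
Variable K : numFieldType.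
Implicit Types (a c : nat -> K) (f u : K -> K) (g la : K).

Lemma taylor_at0_value a f : taylor_at0 a f -> f 0 = a 0%N.
Proof.
move=> /nbhs_singleton f0.
apply: (cvg_unique (@norm_hausdorff _ _) f0).
apply: cvg_near_cst; exists 1%N => // -[//|n] _.
rewrite /series /= big_nat_recl // expr0 mulr1 big1 ?addr0 // => i _.
by rewrite exprS mul0r mulr0.
Qed.

(* A truncation of z^k f^(k)(z); the factor z^k keeps the i-th coefficient of f
   at index i. *)
Definition euler_poly a k N : {poly K} :=
  'X^k * \poly_(i < N) (((i + k) ^_ k)%:R * a (i + k)%N).

Lemma coef_euler_poly a k N i : (i < N)%N ->
  (euler_poly a k N)`_i = (i ^_ k)%:R * a i.
Proof.
move=> iN; rewrite coefXnM; case: ltnP => ik.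
  by rewrite ffact_small // mul0r.
by rewrite coef_poly (leq_ltn_trans (leq_subr _ _) iN) subnK.
Qed.

(** As f(z) = z + O(z^2), a zero would satisfy |z| <= M |z|^2, impossible for 0 < |z| < 1/(M +
    1). *)
Lemma taylor_neq0 a f : a 0%N = 0 -> a 1%N = 1 -> taylor_at0 a f ->
  \forall z \near (0 : K)^', f z != 0.
Proof.
move=> a0 a1 af; have [M M0 fM] := taylor_approx_pseries 2 (nbhs_dnbhs af).
near=> z; apply/negP => /eqP fz.
have z0 : 0 < `|z| by rewrite normr_gt0; near: z; exact: nbhs_dnbhs_neq.
have : `|f z - (\poly_(i < 2) a i).[z]| <= M * `|z| ^+ 2 by exact: (near fM z).
rewrite fz horner_poly !big_ord_recr big_ord0 /= a0 a1.
rewrite sub0r normrN mul0r !add0r mul1r.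
rewrite expr2 mulrA -[X in X <= _]mul1r ler_pM2r //.
have : `|z| < (M + 1)^-1 by near: z; apply: dnbhs0_lt; rewrite invr_gt0 ltr_wpDl.
have M1 : 0 < M + 1 by rewrite ltr_wpDl.
rewrite -[X in _ < X]mul1r ltr_pdivlMr // mulrC => zM Mz.
suff : (1 : K) < 1 by rewrite ltxx.
apply: le_lt_trans zM; apply: (le_trans Mz).
by rewrite ler_wpM2r // lerDl.
Unshelve. all: by end_near.
Qed.

(** Multiplication by z^4 gives every T_k its factor z^k; doubling allows T_0 T_4 and T_1 T_3 to be
    split symmetrically, which produces the weights [b]. *)
Lemma bilinear_coef a (T : nat -> K -> K) g la :
  (forall N k, taylor_approx N (euler_poly a k N) (fun z => z ^+ k * T k z)) ->
  (\forall z \near (0 : K)^', T 0%N z * T 4%N z - 4 * (T 1%N z * T 3%N z)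
      + 3 * (T 2%N z * T 2%N z) = (6 * la * z + g / 2) * (T 0%N z * T 0%N z)) ->
  forall m, \sum_(j < m.+1) (b j (m - j))%:~R * (a j * a (m - j)%N) =
    g * (if (m < 4)%N then 0 else autoconv a (m - 4))
    + 12 * la * (if (m < 5)%N then 0 else autoconv a (m - 5)).
Proof.
move=> aT hir m; have qS := aT m.+1.
pose q k := euler_poly a k m.+1.
have qc k i : (i < m.+1)%N -> (q k)`_i = (i ^_ k)%:R * a i.
  exact: coef_euler_poly.
have H (r : K) := taylor_approx_horner m.+1 r%:P.
have HX n := taylor_approx_horner m.+1 ('X^n : {poly K}).
have qqS k l := taylor_approxM (qS k) (qS l).
have L := taylor_approxD (taylor_approxD (taylor_approxD (taylor_approxD
  (qqS 0%N 4%N) (taylor_approxM (H (-4)) (qqS 1%N 3%N)))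
  (taylor_approxM (H 6) (qqS 2%N 2%N)))
  (taylor_approxM (H (-4)) (qqS 3%N 1%N))) (qqS 4%N 0%N).
(* The doubled right-hand side is g z^4 tau^2 + 12 lambda z^5 tau^2. *)
have Rt := taylor_approxD
  (taylor_approxM (H g) (taylor_approxM (HX 4%N) (qqS 0%N 0%N)))
  (taylor_approxM (H (12 * la)) (taylor_approxM (HX 5%N) (qqS 0%N 0%N))).
have := taylor_approx_inj Rt L _ (ltnSn m).
have conv00 n : (n <= m)%N -> (q 0%N * q 0%N)`_n = autoconv a n.
  move=> nm; rewrite coefM; apply: eq_bigr => j _.
  have jn : (j <= n)%N by rewrite -ltnS.
  by rewrite !qc ?ffactn0 ?mul1r // ltnS; lia.
rewrite !coefD !coefCM !coefXnM.
have -> : (if (m < 4)%N then 0 else (q 0%N * q 0%N)`_(m - 4)) =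
  (if (m < 4)%N then 0 else autoconv a (m - 4)).
  by case: ifP => // _; rewrite conv00 // leq_subr.
have -> : (if (m < 5)%N then 0 else (q 0%N * q 0%N)`_(m - 5)) =
  (if (m < 5)%N then 0 else autoconv a (m - 5)).
  by case: ifP => // _; rewrite conv00 // leq_subr.
move=> ->; last first.
  near=> z; rewrite !hornerC !hornerXn !expr0 !mul1r.
  have h : T 0%N z * T 4%N z - 4 * (T 1%N z * T 3%N z) + 3 * (T 2%N z * T 2%N z) =
    (6 * la * z + g / 2) * (T 0%N z * T 0%N z) by exact: (near hir z).
  transitivity (2 * z ^+ 4 * ((6 * la * z + g / 2) * (T 0%N z * T 0%N z))).
    by field.
  by rewrite -h; ring.
rewrite !coefM !mulr_sumr -!big_split /=; apply: eq_bigr => j _.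
have jm : (j <= m)%N by rewrite -ltnS.
by rewrite !qc ?ltnS ?leq_subr // bE !ffactn0; ring.
Unshelve. all: by end_near.
Qed.

Lemma laurent_coef a c (T : nat -> K -> K) u :
  (forall N k, taylor_approx N (euler_poly a k N) (fun z => z ^+ k * T k z)) ->
  (\forall z \near (0 : K)^',
     series (fun n => c n * z ^+ n) @ \oo --> z ^+ 2 * u z) ->
  (\forall z \near (0 : K)^',
     u z * (T 0%N z * T 0%N z) = T 1%N z * T 1%N z - T 0%N z * T 2%N z) ->
  forall m, \sum_(j < m.+1) c j * autoconv a (m - j) =
    \sum_(j < m.+1) ((j ^_ 1)%:R * ((m - j) ^_ 1)%:R - ((m - j) ^_ 2)%:R)
      * (a j * a (m - j)%N).
Proof.
move=> aT cu uT m; have qS := aT m.+1.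
pose q k := euler_poly a k m.+1.
have qc k i : (i < m.+1)%N -> (q k)`_i = (i ^_ k)%:R * a i.
  exact: coef_euler_poly.
have cS := taylor_approx_pseries m.+1 cu.
have L := taylor_approxM cS (taylor_approxM (qS 0%N) (qS 0%N)).
have Rt := taylor_approxD (taylor_approxM (qS 1%N) (qS 1%N))
  (taylor_approxM (taylor_approx_horner m.+1 (-1)%:P)
     (taylor_approxM (qS 0%N) (qS 2%N))).
have := taylor_approx_inj L Rt _ (ltnSn m).
rewrite coefD coefCM (coefM (\poly_(i < m.+1) c i)) => eqm.
transitivity (\sum_(j < m.+1) (\poly_(i < m.+1) c i)`_j * (q 0%N * q 0%N)`_(m - j)).
  apply: eq_bigr => j _; rewrite coef_poly ltn_ord coefM; congr (_ * _).
  apply: eq_bigr => i _; have im : (i <= m - j)%N by rewrite -ltnS.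
  by rewrite !qc ?ffactn0 ?mul1r // ltnS; lia.
rewrite eqm; last first.
  near=> z; rewrite !hornerC !expr0 !mul1r.
  have h : u z * (T 0%N z * T 0%N z) = T 1%N z * T 1%N z - T 0%N z * T 2%N z.
    exact: (near uT z).
  transitivity (z ^+ 2 * (u z * (T 0%N z * T 0%N z))); first by ring.
  by rewrite h; ring.
rewrite !coefM mulr_sumr -big_split /=; apply: eq_bigr => j _.
have jm : (j <= m)%N by rewrite -ltnS.
by rewrite !qc ?ltnS ?leq_subr // !ffactn0; ring.
Unshelve. all: by end_near.
Qed.

(** The square of the series has no terms z^3, z^4, z^5, so c_3, c_4, c_5 drop out at z^8. Once c_1
    = c_2 = 0, what remains is c_6 + 2 a_7 = -28 a_7. *)
Lemma laurent_coef6 a c :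
  (forall m, \sum_(j < m.+1) c j * autoconv a (m - j) =
    \sum_(j < m.+1) ((j ^_ 1)%:R * ((m - j) ^_ 1)%:R - ((m - j) ^_ 2)%:R)
      * (a j * a (m - j)%N)) ->
  c 0%N = 1 -> a 0%N = 0 -> a 1%N = 1 -> a 2%N = 0 -> a 3%N = 0 -> a 4%N = 0 ->
  c 6%N = - 30 * a 7%N.
Proof.
move=> ac c0 a0 a1 a2 a3 a4.
pose e := (@mul0r K, @mulr0 K, @mul1r K, @mulr1 K, @add0r K, @addr0 K).
have c1 : c 1%N = 0.
  have := ac 3%N; rewrite /autoconv !big_ord_recr !big_ord0 /= !subSS !subn0.
  by rewrite c0 a0 a1 a2 a3 !e.
have c2 : c 2%N = 0.
  have := ac 4%N; rewrite /autoconv !big_ord_recr !big_ord0 /= !subSS !subn0.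
  by rewrite c0 c1 a0 a1 a2 a3 a4 !e.
have := ac 8%N; rewrite /autoconv !big_ord_recr !big_ord0 /= !subSS !subn0.
rewrite c0 c1 c2 a0 a1 a2 a3 a4 !e.
move=> h; have -> : c 6%N = a 7%N + a 7%N + c 6%N - (a 7%N + a 7%N) by ring.
by rewrite h !natr_ffactSr !ffactn0; ring.
Qed.

End TauCoefficients.

(** * The recursion for the normalized tau-function *)

Section TauRecursion.
Variable R : realType.
Local Notation C := (R[i] : numFieldType).

Lemma taylor_approx_euler_poly (a : nat -> C) (f : C -> C) k N : taylor_at0 a f ->
  taylor_approx N (euler_poly a k N) (fun z => z ^+ k * f^`(k)%classic z).
Proof.
move=> /(taylor_at0_derive1n k)[fk _]; apply: taylor_approxM.
  apply: near_eq_taylor_approx (taylor_approx_horner N 'X^k).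
  by near=> z; rewrite hornerXn.
exact/taylor_approx_pseries/nbhs_dnbhs.
Unshelve. all: by end_near.
Qed.

Lemma tau_coefficients_recursion (g2 la g3 : R[i]) (u tau : R[i] -> R[i])
    (c : nat -> R[i]) :
  painleve1_solution g2 la g3 u -> normalized_tau u tau -> tau_expansion c tau ->
  tau_recursion_from g2 la g3 c.
Proof.
move=> [_ p1 _ [l [l0 l6 lu]]] [[_ utau] _ tau1 tau2] ctau.
have {}ctau : taylor_at0 (shift_seq c) tau by exact: ctau.
(* [T k] is the k-th derivative of [tau]; the bilinear identities use only these four properties. *)
have [T [aT DT T0 T1]] : exists T : nat -> C -> C, [/\
    forall N k, taylor_approx N (euler_poly (shift_seq c) k N)
      (fun z => z ^+ k * T k z),
    forall k, \forall z \near (0 : C)^', is_derive (z : C) (1 : C) (T k) (T k.+1 z),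
    T 0%N = tau & T 1%N = derive1 (tau : C -> C)].
  exists (fun k => derive1n k (tau : C -> C)); split => [N k|k||].
  - exact: taylor_approx_euler_poly.
  - exact: nbhs_dnbhs (taylor_at0_derive1n k ctau).2.
  - by rewrite derive1n0.
  - by rewrite derive1n1.
(* The normalization is read off tau'(0) = C_0 and tau''(0) = 2 C_1. *)
have c0 : c 0%N = 1.
  have := taylor_at0_value (taylor_at0_derive1n 1 ctau).1.
  by rewrite derive1n1 tau1 /= mul1r.
have c1 : c 1%N = 0.
  have := taylor_at0_value (taylor_at0_derive1n 2 ctau).1.
  rewrite tau2 /= => /esym/eqP; rewrite mulf_eq0 pnatr_eq0 /=.
  by move/eqP.
have Treg : \forall z \near (0 : C)^',
    T 0%N z != 0 /\ forall k, (k < 4)%N -> is_derive (z : C) (1 : C) (T k) (T k.+1 z).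
  have tau0 := taylor_neq0 (erefl : shift_seq c 0 = 0) c0 ctau.
  near=> z; split; first by rewrite T0; near: z.
  case=> [_|[_|[_|[_|k kk]]]]; last by [].
  - by near: z; exact: DT.
  - by near: z; exact: DT.
  - by near: z; exact: DT.
  - by near: z; exact: DT.
have lT : \forall z \near (0 : C)^', [/\ holomorphic_at u z,
      u z * (T 0%N z * T 0%N z) = T 1%N z * T 1%N z - T 0%N z * T 2%N z &
      (derive1n 2 (u : C -> C) z - 6 * u z ^+ 2) * (T 0%N z * T 0%N z) =
      - (T 0%N z * T 4%N z - 4 * (T 1%N z * T 3%N z) + 3 * (T 2%N z * T 2%N z))].
  (* The identities at z require regularity on a full neighbourhood of z. *)
  apply: filterS (near_dnbhs0_near Treg) => z; apply: log_derivative_bilinear.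
  by rewrite T0 T1.
have rec : tau_recursion g2 la c.
  apply: tau_recursion_of_bilinear c0 _.
  apply: (@bilinear_coef _ _ T) => //.
  apply: filterS lT => z [hu _ h].
  by apply: oppr_inj; rewrite -h p1 //; ring.
split=> //.
(* For n = 2 and n = 3 the last two sums are empty and every product in the first contains C_1. *)
have c2 : c 2%N = 0.
  apply: (mulfI (tau_coef_neq0 C (isT : ~~ free_index 2))).
  rewrite mulr0 [LHS]rec !(big_geq (m := 0)) // big_nat1 c1.
  by rewrite !mulr0 !addr0.
have c3 : c 3%N = 0.
  apply: (mulfI (tau_coef_neq0 C (isT : ~~ free_index 3))).
  rewrite mulr0 [LHS]rec !(big_geq (m := 0)) // big_nat_recl // big_nat1 /= c1 c2.
  by rewrite !(mulr0, mul0r) !addr0 mulr0.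
have lS : \forall z \near (0 : C)^',
    series (fun n => l n * z ^+ n) @ \oo --> z ^+ 2 * u z.
  near=> z; have z0 : z != 0 by near: z; exact: nbhs_dnbhs_neq.
  have -> : series (fun n => l n * z ^+ n) =
      (fun n => z ^+ 2 * series (fun n => l n * z ^ (n%:Z - 2)) n).
    apply/funext => n; rewrite /series /= mulr_sumr; apply: eq_bigr => k _.
    by rewrite mulrCA !exprnP -expfzDr // addrC subrK.
  by apply: cvgM; [exact: cvg_cst|near: z].
have l7 : l 6%N = - 30 * shift_seq c 7.
  apply: laurent_coef6 => //.
  apply: (@laurent_coef _ _ _ T u) => //.
  by apply: filterS lT => z [].
(* With the Laurent coefficient g_3/28 this is C_6 = -g_3/840. *)
have -> : c 6%N = - (1 / 30) * l 6%N by rewrite l7 /=; field.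
by rewrite l6; field.
Unshelve. all: by end_near.
Qed.

End TauRecursion.

Theorem theorem4p1 (R : realType) :
  exists P : nat -> mpoly.mpoly 3 rat,
    (forall n : nat, weighted_homogeneous R[i] n (P n)) /\
    (forall (g2 la g3 : R[i]) (u tau : R[i] -> R[i]) (C : nat -> R[i]),
       painleve1_solution g2 la g3 u ->
       normalized_tau u tau ->
       tau_expansion C tau ->
       (forall n : nat, C n = eval3 (P n) g2 la g3) /\
       tau_recursion_from g2 la g3 C /\
       (forall D : nat -> R[i],
          tau_recursion_from g2 la g3 D -> forall n : nat, D n = C n)).
Proof.
have [P PP] := tau_polynomials; exists P; split.
  exact: tau_polynomials_homogeneous.
move=> g2 la g3 u tau C hu htau hC.
have rC := tau_coefficients_recursion hu htau hC.
(* Every solution of the recursion is the evaluation of the same [P]; this yields both polynomiality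
   of the C_n and uniqueness. *)
have DP D : tau_recursion_from g2 la g3 D ->
    forall n, D n = eval3 (P n) g2 la g3.
  move=> [D0 D1 D6 DR]; have [E0 E1 E6 ES] := eval3_tau g2 la g3 PP.
  apply: tau_recursion_unique ES => [n|n _]; last exact: DR.
  by move=> /or3P[] /eqP ->; rewrite ?D0 ?D1 ?D6.
split; [exact: DP|split=> // D rD n].
by rewrite (DP D) // (DP C).
Qed.
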